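(* Let $S$ be either (i) a commutative semigroup whose universal semilattice is well-founded, or (ii) a solvable inverse semigroup whose semilattice of idempotents $E(S)$ is well-founded. Then every strongly productive ultrafilter on $S$ is idempotent.
   Context: Let $S$ be a multiplicatively written semigroup. For a sequence $\vec{x}=(x_n)_{n\in\omega}$ in $S$, $\mathrm{FP}(\vec{x})$ is the set of all products $\prod_{i\in a}x_i$ (factors taken in increasing order of indices) with $a$ ranging over the finite nonempty subsets of $\omega$; an FP-set is a set of this form. An ultrafilter $p$ on $S$ is strongly productive if for every $A\in p$ there is a sequence $\vec{x}$ with $\mathrm{FP}(\vec{x})\subseteq A$ and $\mathrm{FP}(\vec{x})\in p$. For $x\in S$ and $A\subseteq S$ put $x^{-1}A=\{y\in S: xy\in A\}$; an ultrafilter $p$ is idempotent if $p\cdot p=p$ in $\beta S$, i.e. for every $A\in p$ the set $\{x\in S: x^{-1}A\in p\}$ belongs to $p$. The universal semilattice of $S$ is the quotient $S/\mathcal{N}$ of $S$ by its smallest semilattice congruence $\mathcal{N}$ (a congruence whose quotient is commutative and idempotent). A semilattice $\Lambda$ is ordered by $x\le y$ iff $xy=x$; it is well-founded if every nonempty subset has a minimal element. An inverse semigroup is solvable in the sense of Piochi; in particular the solvable inverse semigroups of class $1$ are exactly the commutative inverse semigroups, and a solvable inverse semigroup of class $n+1$ has a congruence $\gamma$ with $S/\gamma$ commutative such that, for the quotient map $f:S\to S/\gamma$, the inverse subsemigroup $f^{-1}[E(S/\gamma)]$ is solvable of class $n$. Solvable groups are exactly the solvable inverse semigroups with one idempotent.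 *)

(* Defs.v *)
From Stdlib Require Import List Sorted Arith.
Import ListNotations.

Section Semigroup.
Variable S : Type.
Variable op : S -> S -> S.

Definition associative_op : Prop :=
  forall x y z, op x (op y z) = op (op x y) z.

Definition commutative_op : Prop := forall x y, op x y = op y x.

Definition ultrafilter (U : (S -> Prop) -> Prop) : Prop :=
  ~ U (fun _ => False) /\
  U (fun _ => True) /\
  (forall A B : S -> Prop, U A -> (forall x, A x -> B x) -> U B) /\
  (forall A B : S -> Prop, U A -> U B -> U (fun x => A x /\ B x)) /\
  (forall A : S -> Prop, U A \/ U (fun x => ~ A x)).

Definition list_prod (xs : nat -> S) (i : nat) (l : list nat) : S :=
  fold_left (fun acc j => op acc (xs j)) l (xs i).

(* FP(xs): all products over finite nonempty subsets of omega, written as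
   strictly increasing nonempty lists of indices *)
Definition FP (xs : nat -> S) (y : S) : Prop :=
  exists (i : nat) (l : list nat),
    StronglySorted lt (i :: l) /\ y = list_prod xs i l.

Definition strongly_productive (U : (S -> Prop) -> Prop) : Prop :=
  forall A, U A -> exists xs : nat -> S,
    (forall y, FP xs y -> A y) /\ U (FP xs).

Definition idempotent_uf (U : (S -> Prop) -> Prop) : Prop :=
  forall A, U A -> U (fun x => U (fun y => A (op x y))).

Definition congruence (R : S -> S -> Prop) : Prop :=
  (forall x, R x x) /\ (forall x y, R x y -> R y x) /\
  (forall x y z, R x y -> R y z -> R x z) /\
  (forall x y z, R x y -> R (op z x) (op z y) /\ R (op x z) (op y z)).

Definition semilattice_congruence (R : S -> S -> Prop) : Prop :=
  congruence R /\ (forall x y, R (op x y) (op y x)) /\ (forall x, R (op x x) x).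

Definition univ_semilattice_cong (x y : S) : Prop :=
  forall R, semilattice_congruence R -> R x y.

(* The universal semilattice S/N, ordered by [x] <= [y] iff [x][y] = [x],
   is well-founded: every nonempty subset of S/N (= image of some nonempty
   P : S -> Prop) has a minimal element. *)
Definition univ_semilattice_wf : Prop :=
  let N := univ_semilattice_cong in
  forall P : S -> Prop, (exists a, P a) ->
    exists a, P a /\ forall b, P b -> N (op b a) b -> N b a.

Definition idem (e : S) : Prop := op e e = e.

Definition idempotents_wf : Prop :=
  forall P : S -> Prop, (forall e, P e -> idem e) -> (exists e, P e) ->
    exists e, P e /\ forall f, P f -> op f e = f -> f = e.

Definition inverse_semigroup : Prop :=
  forall x, exists! y, op (op x y) x = x /\ op (op y x) y = y.

Definition congruence_on (T : S -> Prop) (R : S -> S -> Prop) : Prop :=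
  (forall x, T x -> R x x) /\
  (forall x y, T x -> T y -> R x y -> R y x) /\
  (forall x y z, T x -> T y -> T z -> R x y -> R y z -> R x z) /\
  (forall x y z, T x -> T y -> T z -> R x y ->
       R (op z x) (op z y) /\ R (op x z) (op y z)).

(* Solvability in the sense of Piochi, for an inverse subsemigroup T of S:
   class 1 = commutative; class n+1 = has a congruence g with T/g commutative
   such that f^{-1}[E(T/g)] = {x in T | g (x x) x} is solvable of class n. *)
Inductive solvable_class : nat -> (S -> Prop) -> Prop :=
| solvable_class1 (T : S -> Prop) :
    (forall x y, T x -> T y -> op x y = op y x) -> solvable_class 1 T
| solvable_classS (n : nat) (T : S -> Prop) (g : S -> S -> Prop) :
    congruence_on T g ->
    (forall x y, T x -> T y -> g (op x y) (op y x)) ->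
    solvable_class n (fun x => T x /\ g (op x x) x) ->
    solvable_class (Datatypes.S n) T.

Definition solvable_inverse_semigroup : Prop :=
  inverse_semigroup /\ exists n, solvable_class n (fun _ => True).

End Semigroup.

(* Main.v *)
Require Import Defs.
From Stdlib Require Import List Sorted Arith.
From Stdlib Require Import Lia Permutation Classical ClassicalEpsilon.
From Stdlib Require Import FunctionalExtensionality PropExtensionality.
Import ListNotations.

(** Call a member B of the ultrafilter U regular if, for every FP-set generated by
    a sequence x inside B, no set x_n * FP(x_(n+1), x_(n+2), ...) is in U.  A
    nonprincipal U with a regular member is idempotent: dropping initial terms of
    x then keeps FP(x) in U, and left translation by a product of initial terms
    sends a tail of FP(x) into FP(x).

    In an abelian group, colour the elements other than 1 with three colours so
    that y and y^2 always differ.  A colour class in U is regular: if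
    b * FP(tail) is in U, where b = x_n, it contains some b z0, b z1 and their
    product b z', and the relation b z0 z1 = z' can be rearranged into p^2 = q
    with p, q in FP(x).

    Well-foundedness provides either a regular set, since x * S is too small to be
    in U, or a single class of mutual divisibility (up to powers, in the
    commutative case) in U.  Such a class is a group modulo a nil semigroup or
    modulo the congruence defining solvability; in the latter case one descends to
    the preimage of the idempotents. *)

(** * Three-colouring the graph of a self-map *)

Section Coloring.
Variables (X : Type) (f : X -> X).

Let it (n : nat) (x : X) : X := Nat.iter n f x.

Lemma iter_add (m n : nat) (x : X) : it (m + n) x = it m (it n x).
Proof. apply Nat.iter_add. Qed.

Lemma iter_step (n : nat) (x : X) : it n (f x) = it (S n) x.
Proof. unfold it; symmetry; apply Nat.iter_succ_r. Qed.

Let conn (x y : X) : Prop := exists m n, it m x = it n y.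
Let periodic (x : X) : Prop := exists n, it (S n) x = x.

Lemma iter_periodic (x : X) (n : nat) :
  it n x = x -> forall k, it (k * n) x = x.
Proof.
  intros H k; induction k as [|k IH]; [reflexivity|].
  simpl Nat.mul; rewrite iter_add, IH; exact H.
Qed.

Lemma conn_step (x y : X) : conn (f x) y <-> conn x y.
Proof.
  split; intros (m & n & H).
  - exists (S m), n; rewrite <- iter_step; exact H.
  - exists m, (S n). rewrite iter_step. cbn. f_equal. exact H.
Qed.

(** The admissible roots of the component of [x]: points of its cycle if it has one, otherwise any
    point. *)
Let good (x y : X) : Prop :=
  conn x y /\ ((exists z, conn x z /\ periodic z) -> periodic y).

Lemma good_exists (x : X) : exists y, good x y.
Proof.
  destruct (classic (exists z, conn x z /\ periodic z)) as [(z & H1 & H2)|H].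
  - exists z; split; auto.
  - exists x; split; [exists 0, 0; reflexivity | tauto].
Qed.

Lemma good_step (x : X) : good (f x) = good x.
Proof.
  apply functional_extensionality; intro y; apply propositional_extensionality.
  assert (E : (exists z, conn (f x) z /\ periodic z) <->
              (exists z, conn x z /\ periodic z)).
  { split; intros (z & H1 & H2); exists z; split; auto; apply conn_step; auto. }
  unfold good; rewrite (conn_step x y); tauto.
Qed.

(** Chosen from the predicate [good x] alone, which [x] and [f x] share, so that a whole component
    gets the same root. *)
Let root (x : X) : X := epsilon (inhabits x) (good x).

Lemma root_spec (x : X) : good x (root x).
Proof. apply epsilon_spec, good_exists. Qed.

Lemma root_step (x : X) : root (f x) = root x.
Proof.
  unfold root; rewrite good_step.
  rewrite (proof_irrelevance _ (inhabits (f x)) (inhabits x)); reflexivity.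
Qed.

(** Where the orbits of [x] and of the root meet, [n * L] further steps complete [n] turns of period
    [S L] around the cycle. *)
Lemma hits_periodic_root (x : X) :
  periodic (root x) -> exists k, it k x = root x.
Proof.
  intros (L & HL); destruct (root_spec x) as ((m & n & H) & _).
  exists (n * L + m); rewrite iter_add, H, <- iter_add.
  replace (n * L + n) with (n * S L) by lia.
  apply iter_periodic; exact HL.
Qed.

(** The iterates of a nonperiodic root are distinct, since a repetition would be a periodic point of
    the component. Hence [n' - n = m' - m], and the two sums differ by an even number. *)
Lemma iter_parity (x : X) (m n m' n' : nat) :
  ~ periodic (root x) ->
  it m x = it n (root x) -> it m' x = it n' (root x) ->
  Nat.even (m + n) = Nat.even (m' + n').
Proof.
  intros Hp.
  assert (K : forall a b, it a (root x) = it b (root x) -> ~ a < b).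
  { intros a b H Hab; apply Hp.
    destruct (root_spec x) as ((u & v & Hc) & Hg); apply Hg.
    exists (it a (root x)); split.
    - exists (a + u), v; rewrite iter_add, Hc, <- !iter_add; f_equal; lia.
    - exists (b - a - 1); rewrite <- iter_add, H; f_equal; lia. }
  assert (W : forall m n m' n', m <= m' ->
    it m x = it n (root x) -> it m' x = it n' (root x) ->
    Nat.even (m + n) = Nat.even (m' + n')).
  { clear m n m' n'; intros m n m' n' Hm H H'.
    assert (E : it (m' - m + n) (root x) = it n' (root x)).
    { rewrite iter_add, <- H, <- iter_add, <- H'; f_equal; lia. }
    pose proof (K _ _ E); pose proof (K _ _ (eq_sym E)).
    replace (m' + n') with (m + n + 2 * (m' - m)) by lia.
    rewrite Nat.even_add_mul_2; reflexivity. }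
  intros H H'; destruct (Nat.le_ge_cases m m'); [|symmetry]; eauto.
Qed.

(* On a component with a cycle, colour by the parity of the distance to a fixed
   point of the cycle, that point getting a third colour; on an acyclic
   component, parity of the signed distance to a root is well defined. *)
Lemma functional_graph_coloring :
  exists c : X -> nat, (forall x, c x < 3) /\ (forall x, f x <> x -> c (f x) <> c x).
Proof.
  set (least := fun x k => it k x = root x /\ forall j, it j x = root x -> k <= j).
  set (evenp := fun x => exists m n, it m x = it n (root x) /\ Nat.even (m + n) = true).
  set (col := fun x i =>
    (periodic (root x) /\ exists k, least x k /\
        i = if k =? 0 then 2 else if Nat.even k then 0 else 1) \/
    (~ periodic (root x) /\ exists m n, it m x = it n (root x) /\
        i = if Nat.even (m + n) then 0 else 1)).
  assert (Hex : forall x, exists i, col x i).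
  { intro x; destruct (classic (periodic (root x))) as [H|H].
    - destruct (hits_periodic_root x H) as (k & Hk).
      destruct (dec_inh_nat_subset_has_unique_least_element
                  (fun k => it k x = root x)) as (k0 & (H1 & H2) & _).
      { intro; apply classic. }
      { exists k; exact Hk. }
      eexists; left; split; auto; exists k0; split; [split; auto|reflexivity].
    - destruct (root_spec x) as ((m & n & Hc) & _).
      eexists; right; split; auto; exists m, n; split; auto. }
  exists (fun x => proj1_sig (constructive_indefinite_description _ (Hex x))).
  split.
  - intro x; destruct constructive_indefinite_description as [i Hi]; simpl.
    destruct Hi as [(_ & k & _ & ->)|(_ & m & n & _ & ->)];
      [destruct (k =? 0), (Nat.even k) | destruct (Nat.even (m + n))]; lia.
  - intros x Hx.
    destruct (constructive_indefinite_description _ (Hex (f x))) as [i Hi].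
    destruct (constructive_indefinite_description _ (Hex x)) as [j Hj]; simpl.
    unfold col in Hi; rewrite root_step in Hi.
    destruct Hi as [(Hp & k & Hk & ->)|(Hp & m & n & Hmn & ->)];
    destruct Hj as [(Hp' & k' & Hk' & ->)|(Hp' & m' & n' & Hmn' & ->)]; try tauto.
    + destruct Hk as [Hk Hkl], Hk' as [Hk' Hkl'].
      rewrite root_step in Hk, Hkl.
      destruct k' as [|k'].
      (* Here [x] is the root, of colour 2. Its image has another colour unless it is the root too,
         which means [f x = x]. *)
      * destruct k as [|k].
        -- exfalso; apply Hx; cbn in Hk, Hk'; congruence.
        -- simpl Nat.eqb; cbv iota; destruct (Nat.even (S k)); lia.
      (* Off the root, [f x] is exactly one step closer: the parity flips, or [f x] is the root and
         gets colour 2. *)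
      * assert (k = k').
        { rewrite iter_step in Hk; rewrite <- iter_step in Hk'.
          specialize (Hkl _ Hk'); specialize (Hkl' _ Hk); lia. }
        subst k; simpl (S k' =? 0); cbv iota.
        rewrite Nat.even_succ, <- Nat.negb_even.
        destruct (k' =? 0), (Nat.even k'); simpl; lia.
    (* A meeting after [m] steps from [f x] is one after [S m] steps from [x], so the parity
       flips. *)
    + rewrite iter_step in Hmn.
      pose proof (iter_parity x _ _ _ _ Hp Hmn Hmn') as E.
      simpl plus in E; rewrite Nat.even_succ, <- Nat.negb_even in E.
      rewrite <- E; destruct (Nat.even (m + n)); simpl; lia.
Qed.

End Coloring.

(** * Products over index lists and FP-sets *)

Section StronglyProductive.
Variables (X : Type) (op : X -> X -> X).
Hypothesis op_assoc : associative_op X op.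

(** Right multiplication of [s] by a word; the empty word is allowed although [X] may lack an
    identity. *)
Let act (xs : nat -> X) (l : list nat) (s : X) : X :=
  fold_left (fun acc j => op acc (xs j)) l s.

Lemma act_app (xs : nat -> X) (l l' : list nat) (s : X) :
  act xs (l ++ l') s = act xs l' (act xs l s).
Proof. apply fold_left_app. Qed.

Lemma op_act (xs : nat -> X) (l : list nat) (s t : X) :
  op s (act xs l t) = act xs l (op s t).
Proof.
  revert t; induction l as [|j l IH]; intro t; [reflexivity|].
  simpl; rewrite IH, op_assoc; reflexivity.
Qed.

Definition FP_from (n : nat) (xs : nat -> X) (y : X) : Prop :=
  exists (i : nat) (l : list nat),
    n <= i /\ StronglySorted lt (i :: l) /\ y = Defs.list_prod X op xs i l.

Lemma FP_from_FP (n : nat) (xs : nat -> X) (y : X) : FP_from n xs y -> FP X op xs y.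
Proof. intros (i & l & _ & H); exists i, l; exact H. Qed.

Lemma FP_FP_from0 (xs : nat -> X) (y : X) : FP X op xs y -> FP_from 0 xs y.
Proof. intros (i & l & H); exists i, l; split; [lia | exact H]. Qed.

Lemma FP_term (xs : nat -> X) (n : nat) : FP X op xs (xs n).
Proof. exists n, []; split; [repeat constructor | reflexivity]. Qed.

Lemma FP_two_terms (xs : nat -> X) : FP X op xs (op (xs 0) (xs 1)).
Proof. exists 0, [1]; split; [repeat constructor | reflexivity]. Qed.

(** The cases are: [n] is the only index, all indices exceed [n], or [n] is followed by larger
    ones. *)
Lemma FP_from_split (n : nat) (xs : nat -> X) (y : X) :
  FP_from n xs y ->
  y = xs n \/ FP_from (S n) xs y \/ exists z, FP_from (S n) xs z /\ y = op (xs n) z.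
Proof.
  intros (i & l & Hn & Hs & ->).
  destruct (Nat.eq_dec n i) as [<-|Hne].
  - destruct l as [|j l]; [left; reflexivity|right; right].
    apply StronglySorted_inv in Hs as [Hs Hf]; inversion_clear Hf.
    exists (Defs.list_prod X op xs j l); split.
    + exists j, l; repeat split; auto; lia.
    + symmetry; apply op_act.
  - right; left; exists i, l; repeat split; auto; lia.
Qed.

(** Beyond the largest index used in [x], index lists can be appended and stay increasing. *)
Lemma FP_mul_from (xs : nat -> X) (x : X) :
  FP X op xs x -> exists n, forall y, FP_from n xs y -> FP X op xs (op x y).
Proof.
  intros (i & l & Hs & ->).
  exists (S (list_max (i :: l))); intros y (j & m & Hj & Hm & ->).
  exists i, (l ++ j :: m); split.
  - change (StronglySorted lt ((i :: l) ++ (j :: m))).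
    assert (Hb : Forall (fun k => k < j) (i :: l)).
    { pose proof (proj1 (list_max_le (i :: l) _) (le_n _)) as Hle.
      eapply Forall_impl; [|exact Hle]; cbv beta; intros; lia. }
    clear Hj; induction (i :: l) as [|k r IH]; [exact Hm|].
    apply StronglySorted_inv in Hs as [Hs Hf]; inversion_clear Hb.
    simpl; constructor; [auto|].
    apply Forall_app; split; [exact Hf|].
    apply StronglySorted_inv in Hm as [_ Hm].
    constructor; [assumption|].
    eapply Forall_impl; [|exact Hm]; simpl; intros; lia.
  - unfold Defs.list_prod; rewrite fold_left_app; simpl.
    apply (op_act xs m).
Qed.

(** Forgets the order of the indices but keeps their distinctness, which bounds multiplicities in
    [square_in_FP]. *)
Lemma FP_from_act (n : nat) (xs : nat -> X) (z : X) :
  FP_from n xs z ->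
  exists l, NoDup l /\ (forall k, In k l -> n <= k) /\
            forall s, op s z = act xs l s.
Proof.
  intros (i & l & Hn & Hs & ->); exists (i :: l); repeat split.
  - clear Hn; induction (i :: l) as [|k r IH]; constructor;
      apply StronglySorted_inv in Hs as [Hs Hf]; auto.
    intro Hin; rewrite Forall_forall in Hf; specialize (Hf _ Hin); lia.
  - apply StronglySorted_inv in Hs as [_ Hf]; rewrite Forall_forall in Hf.
    intros k [<-|Hk]; [exact Hn|]; specialize (Hf _ Hk); lia.
  - intro s; apply (op_act xs l).
Qed.

(** The index [k] witnesses that the selected set is nonempty, as membership in an FP-set
    demands. *)
Lemma FP_subset_act (xs : nat -> X) (p : nat -> bool) (n k : nat) :
  k < n -> p k = true ->
  exists y, FP X op xs y /\ forall s, op s y = act xs (filter p (seq 0 n)) s.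
Proof.
  intros Hk Hp.
  assert (Hs : StronglySorted lt (filter p (seq 0 n))).
  { generalize 0; clear; induction n as [|n IH]; intro a; simpl; [constructor|].
    destruct (p a); auto; constructor; auto.
    apply Forall_forall; intros x Hx; apply filter_In in Hx as [Hx _].
    apply in_seq in Hx; lia. }
  assert (Hin : In k (filter p (seq 0 n))).
  { apply filter_In; split; auto; apply in_seq; lia. }
  destruct (filter p (seq 0 n)) as [|i l]; [destruct Hin|].
  exists (Defs.list_prod X op xs i l); split; [exists i, l; auto|].
  intro s; apply (op_act xs l).
Qed.

Lemma count_occ_filter_seq (p : nat -> bool) (n k : nat) :
  (p k = true -> k < n) ->
  count_occ Nat.eq_dec (filter p (seq 0 n)) k = if p k then 1 else 0.
Proof.
  intro H; destruct (p k) eqn:E.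
  - apply NoDup_count_occ'; [apply NoDup_filter, seq_NoDup|].
    apply filter_In; split; auto; apply in_seq; specialize (H eq_refl); lia.
  - apply count_occ_not_In; rewrite filter_In, E; intros [_ ?]; discriminate.
Qed.

(** * Commutative quotients and cancellation *)

(* [ac_dom], [ac_refl] and [ac_mul] together force [D] to be closed under [op]. *)
Record abelian_congruence (D : X -> Prop) (R : X -> X -> Prop) : Prop := {
  ac_dom : forall x y, R x y -> D x /\ D y;
  ac_refl : forall x, D x -> R x x;
  ac_sym : forall x y, R x y -> R y x;
  ac_trans : forall x y z, R x y -> R y z -> R x z;
  ac_mul : forall x x' y y', R x x' -> R y y' -> R (op x y) (op x' y');
  ac_comm : forall x y, D x -> D y -> R (op x y) (op y x) }.

Lemma ac_closed (D : X -> Prop) (R : X -> X -> Prop) :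
  abelian_congruence D R -> forall x y, D x -> D y -> D (op x y).
Proof.
  intros A x y Hx Hy.
  apply (ac_dom _ _ A (op x y) (op x y)), (ac_mul _ _ A); apply (ac_refl _ _ A); auto.
Qed.

Lemma ac_act_permutation (D : X -> Prop) (R : X -> X -> Prop) (xs : nat -> X) :
  abelian_congruence D R -> (forall n, D (xs n)) ->
  forall l l', Permutation l l' ->
  forall s s', R s s' -> R (act xs l s) (act xs l' s').
Proof.
  intros A Hxs l l' P; induction P as [|j l l' P IH|i j l|l l' l'' P1 IH1 P2 IH2];
    intros s s' H; simpl.
  - exact H.
  - apply IH, (ac_mul _ _ A); auto; apply (ac_refl _ _ A); auto.
  - assert (E : R (op (op s (xs j)) (xs i)) (op (op s' (xs i)) (xs j))).
    { rewrite <- !op_assoc; apply (ac_mul _ _ A); auto; apply (ac_comm _ _ A); auto. }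
    revert E; generalize (op (op s (xs j)) (xs i)), (op (op s' (xs i)) (xs j)).
    clear - A Hxs; induction l as [|k l IH]; intros a b E; [exact E|].
    apply IH, (ac_mul _ _ A); auto; apply (ac_refl _ _ A); auto.
  - eapply (ac_trans _ _ A); [apply IH1, H|].
    apply IH2, (ac_refl _ _ A); apply (ac_dom _ _ A) in H; tauto.
Qed.

Definition cancellative (R : X -> X -> Prop) (D : X -> Prop) : Prop :=
  forall x y c, D x -> D y -> D c -> R (op x c) (op y c) -> R x y.

Lemma cancel_act (D : X -> Prop) (R : X -> X -> Prop) (xs : nat -> X) :
  abelian_congruence D R -> cancellative R D -> (forall n, D (xs n)) ->
  forall l s s', D s -> D s' -> R (act xs l s) (act xs l s') -> R s s'.
Proof.
  intros A C Hxs l; induction l as [|j l IH]; intros s s' Hs Hs' H; [exact H|].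
  apply (C _ _ (xs j)); auto.
  apply IH; auto; apply (ac_closed _ _ A); auto.
Qed.

(* Multiplicity [k] of an index in [b z0 b z1] minus that in [b z'] lies in
   {-1,0,1,2}, and [2 [k >= 1] - [k odd] = k]: so the square of the subproduct
   over the indices with [k >= 1] equals the subproduct over those with [k] odd. *)
Lemma square_in_FP (D : X -> Prop) (R : X -> X -> Prop) (xs : nat -> X) (n : nat)
    (z0 z1 z' : X) :
  abelian_congruence D R -> cancellative R D ->
  (forall y, FP X op xs y -> D y) ->
  FP_from (S n) xs z0 -> FP_from (S n) xs z1 -> FP_from (S n) xs z' ->
  op (op (xs n) z0) (op (xs n) z1) = op (xs n) z' ->
  exists p q, FP X op xs p /\ FP X op xs q /\ R (op p p) q.
Proof.
  intros A C HD H0 H1 H2 E.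
  destruct (FP_from_act _ _ _ H0) as (l0 & N0 & G0 & F0).
  destruct (FP_from_act _ _ _ H1) as (l1 & N1 & G1 & F1).
  destruct (FP_from_act _ _ _ H2) as (l2 & N2 & G2 & F2).
  assert (Hxs : forall k, D (xs k)) by (intro; apply HD, FP_term).
  (* The index words of the two sides of [E]; [n] occurs twice in [L] and once in [L']. *)
  set (L := (n :: l0) ++ (n :: l1)); set (L' := n :: l2).
  assert (EL : forall s, act xs L s = act xs L' s).
  { intro s; unfold L, L'; rewrite act_app; simpl.
    rewrite <- F2, <- F1, <- F0, <- !op_assoc, <- E, <- !op_assoc; reflexivity. }
  set (c := count_occ Nat.eq_dec L); set (c' := count_occ Nat.eq_dec L').
  assert (Hc : forall k, (k = n -> c k = 2 /\ c' k = 1) /\ c k <= 2 /\ c' k <= 1).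
  { intro k.
    pose proof (proj1 (NoDup_count_occ Nat.eq_dec l0) N0 k) as K0.
    pose proof (proj1 (NoDup_count_occ Nat.eq_dec l1) N1 k) as K1.
    pose proof (proj1 (NoDup_count_occ Nat.eq_dec l2) N2 k) as K2.
    assert (Z : forall l, (forall j, In j l -> S n <= j) ->
                  count_occ Nat.eq_dec l n = 0).
    { intros l Hl; apply count_occ_not_In; intro Hin; specialize (Hl _ Hin); lia. }
    unfold c, c', L, L'; rewrite count_occ_app; simpl.
    destruct (Nat.eq_dec n k) as [<-|Hne].
    - rewrite !Z by assumption; lia.
    - repeat split; intros; try lia. }
  (* The sum [c k + c' k] has the parity of the difference and avoids truncated subtraction. *)
  set (p := fun k => c' k <? c k); set (q := fun k => Nat.odd (c k + c' k)).
  set (M := S (list_max (L ++ L'))).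
  assert (HM : forall k, c k + c' k <> 0 -> k < M).
  { intros k Hk.
    assert (Hin : In k (L ++ L')).
    { apply (count_occ_In Nat.eq_dec); rewrite count_occ_app; fold (c k) (c' k); lia. }
    pose proof (proj1 (list_max_le (L ++ L') _) (le_n _)) as Hle.
    rewrite Forall_forall in Hle; specialize (Hle _ Hin); unfold M; lia. }
  set (P := filter p (seq 0 M)); set (Q := filter q (seq 0 M)).
  assert (Perm : Permutation (P ++ P ++ L') (L ++ Q)).
  { apply (Permutation_count_occ Nat.eq_dec); intro k.
    rewrite !count_occ_app; fold (c k) (c' k); unfold P, Q.
    rewrite !count_occ_filter_seq.
    - destruct (Hc k) as (_ & B1 & B2); unfold p, q.
      destruct (c k) as [|[|[|?]]], (c' k) as [|[|?]]; simpl; lia.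
    - intro Hk; apply HM; intro H; unfold q in Hk; rewrite H in Hk; discriminate.
    - intro Hk; apply HM; intro H; unfold p in Hk; apply Nat.ltb_lt in Hk; lia. }
  (* The multiplicity difference at [n] is 1, so [n] lies in both index sets and neither is
     empty. *)
  destruct (Hc n) as ((B1 & B2) & _); auto.
  assert (Hn : n < M) by (apply HM; lia).
  destruct (FP_subset_act xs p M n Hn) as (u & Hu & Fu).
  { unfold p; rewrite B1, B2; reflexivity. }
  destruct (FP_subset_act xs q M n Hn) as (v & Hv & Fv).
  { unfold q; rewrite B1, B2; reflexivity. }
  exists u, v; repeat split; auto.
  assert (Du := HD _ Hu); assert (Dv := HD _ Hv); set (s := xs n).
  assert (Ds : D s) by apply Hxs.
  (* With words acting on [s], [P P L'] permutes to [L Q], which acts like [L' Q] by [EL] and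
     permutes to [Q L']; then [L'] cancels. *)
  assert (K : R (op s (op u u)) (op s v)).
  { rewrite op_assoc, Fv, !Fu, <- act_app.
    apply (cancel_act _ _ xs A C Hxs L').
    - rewrite act_app, <- !Fu; repeat apply (ac_closed _ _ A); auto.
    - fold Q; rewrite <- Fv; apply (ac_closed _ _ A); auto.
    - fold P Q; rewrite <- !act_app, <- app_assoc.
      eapply (ac_trans _ _ A).
      + apply (ac_act_permutation _ _ xs A Hxs _ _ Perm), (ac_refl _ _ A), Ds.
      + rewrite act_app, EL, <- act_app.
        apply (ac_act_permutation _ _ xs A Hxs); [apply Permutation_app_comm|].
        apply (ac_refl _ _ A), Ds. }
  apply (C _ _ s); auto; [apply (ac_closed _ _ A); auto|].
  eapply (ac_trans _ _ A); [apply (ac_comm _ _ A); auto; apply (ac_closed _ _ A); auto|].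
  eapply (ac_trans _ _ A); [exact K|]; apply (ac_comm _ _ A); auto.
Qed.

(** Colours the graph of squaring on the quotient: the class of [x] is the predicate [R x], and [f]
    extends squaring of classes to all predicates. *)
Lemma square_coloring (D : X -> Prop) (R : X -> X -> Prop) :
  abelian_congruence D R ->
  exists c : X -> nat, (forall x, c x < 3) /\
    forall x y, D x -> ~ R (op x x) x -> R (op x x) y -> c x <> c y.
Proof.
  intro A.
  set (f := fun (P : X -> Prop) z => exists x, P x /\ R (op x x) z).
  destruct (functional_graph_coloring (X -> Prop) f) as (c & Hc3 & Hc).
  exists (fun x => c (R x)); split; [auto|].
  intros x y Dx Hx Hy.
  assert (Ef : f (R x) = R y).
  { apply functional_extensionality; intro z; apply propositional_extensionality.
    split.
    - intros (x' & Hx' & Hz).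
      apply (ac_trans _ _ A _ (op x x)); [apply (ac_sym _ _ A), Hy|].
      apply (ac_trans _ _ A _ (op x' x')); [apply (ac_mul _ _ A)|]; auto.
    - intro Hz; exists x; split; [apply (ac_refl _ _ A), Dx|].
      apply (ac_trans _ _ A _ y); auto. }
  intro E; apply (Hc (R x)); [|rewrite Ef; auto].
  rewrite Ef; intro E'.
  apply Hx, (ac_trans _ _ A _ y); [exact Hy|].
  rewrite E'; apply (ac_refl _ _ A), Dx.
Qed.

(** * Regular sets in a strongly productive ultrafilter *)

Variable U : (X -> Prop) -> Prop.
Hypothesis HU : ultrafilter X U.
Hypothesis HSP : strongly_productive X op U.

Lemma uf_mono (A B : X -> Prop) : (forall x, A x -> B x) -> U A -> U B.
Proof. intros H HA; exact (proj1 (proj2 (proj2 HU)) A B HA H). Qed.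

Lemma uf_and (A B : X -> Prop) : U A -> U B -> U (fun x => A x /\ B x).
Proof. apply HU. Qed.

Lemma uf_cases (A B : X -> Prop) : U B -> U A \/ U (fun x => B x /\ ~ A x).
Proof.
  intro HB; destruct (proj2 (proj2 (proj2 (proj2 HU))) A) as [H|H]; auto.
  right; apply uf_and; auto.
Qed.

Lemma uf_false (A : X -> Prop) : U A -> (forall x, ~ A x) -> False.
Proof. intros HA H; apply HU; exact (uf_mono _ _ H HA). Qed.

Lemma uf_or (A B C : X -> Prop) :
  U A -> (forall x, A x -> B x \/ C x) -> U B \/ U C.
Proof.
  intros HA H; destruct (uf_cases B A HA) as [K|K]; auto.
  right; revert K; apply uf_mono; intros x [Ax Bx]; destruct (H x Ax); tauto.
Qed.

(** An FP-set inside the singleton of [e] contains two terms and their product, all equal to [e]. *)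
Lemma principal_idempotent (e : X) : U (fun x => x = e) -> idempotent_uf X op U.
Proof.
  intro He; destruct (HSP _ He) as (xs & Hxs & _).
  assert (Ee : op e e = e).
  { pose proof (Hxs _ (FP_two_terms xs)) as E.
    rewrite (Hxs _ (FP_term xs 0)), (Hxs _ (FP_term xs 1)) in E; exact E. }
  intros A HA.
  assert (Ae : A e).
  { apply NNPP; intro N; apply (uf_false _ (uf_and _ _ HA He)).
    intros x [Ax ->]; auto. }
  apply (uf_mono (fun x => x = e)); [|exact He]; intros x ->.
  apply (uf_mono (fun x => x = e)); [|exact He]; intros y ->.
  rewrite Ee; exact Ae.
Qed.

Definition regular (B : X -> Prop) : Prop :=
  U B /\ forall xs n, (forall y, FP X op xs y -> B y) ->
    ~ U (fun w => exists z, FP_from (S n) xs z /\ w = op (xs n) z).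

Lemma regular_idempotent (B : X -> Prop) : regular B -> idempotent_uf X op U.
Proof.
  intros [HB HR].
  destruct (classic (exists e, U (fun x => x = e))) as [(e & He)|Hne].
  { exact (principal_idempotent e He). }
  intros A HA.
  destruct (HSP _ (uf_and _ _ HA HB)) as (xs & Hxs & Hfp).
  (* Of the three pieces given by [FP_from_split], nonprincipality excludes the single point and
     regularity excludes the translate. *)
  assert (Htail : forall n, U (FP_from n xs)).
  { induction n as [|n IH].
    - revert Hfp; apply uf_mono, FP_FP_from0.
    - destruct (uf_or _ _ _ IH (FP_from_split n xs)) as [H|H].
      { exfalso; apply Hne; exists (xs n); exact H. }
      destruct (uf_or _ _ _ H (fun x Hx => Hx)) as [K|K]; [exact K|].
      exfalso; apply (HR xs n); [|exact K]; intros y Hy; apply Hxs; auto. }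
  revert Hfp; apply uf_mono; intros x Hx.
  destruct (FP_mul_from xs x Hx) as (n & Hn).
  apply (uf_mono _ _ (fun y Hy => proj1 (Hxs _ (Hn y Hy)))), Htail.
Qed.

(** In the cancellative quotient only an identity is fixed by squaring. Unless its class is in [U],
    one of the three colour classes outside it is in [U]. *)
Lemma cancellative_regular (D : X -> Prop) (R : X -> X -> Prop) :
  abelian_congruence D R -> cancellative R D -> U D ->
  U (fun x => D x /\ R (op x x) x) \/ exists B, regular B.
Proof.
  intros A C HD.
  destruct (uf_cases (fun x => D x /\ R (op x x) x) D HD) as [H|H]; [auto|right].
  destruct (square_coloring D R A) as (c & Hc3 & Hc).
  set (B := fun i x => (D x /\ ~ (D x /\ R (op x x) x)) /\ c x = i).
  assert (HB : exists i, U (B i)).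
  { destruct (uf_or _ (B 0) (fun x => B 1 x \/ B 2 x) H) as [K|K]; [|eauto|].
    - intros x Hx; specialize (Hc3 x); unfold B.
      destruct (c x) as [|[|[|?]]]; try lia; tauto.
    - destruct (uf_or _ _ _ K (fun x Hx => Hx)); eauto. }
  destruct HB as (i & HB); exists (B i); split; [exact HB|].
  (* Strong productivity applied to the translate itself yields two of its points whose product lies
     in it again. *)
  intros xs n Hxs HT; destruct (HSP _ HT) as (ys & Hys & _).
  destruct (Hys _ (FP_term ys 0)) as (z0 & F0 & E0).
  destruct (Hys _ (FP_term ys 1)) as (z1 & F1 & E1).
  destruct (Hys _ (FP_two_terms ys)) as (z' & F' & E').
  rewrite E0, E1 in E'.
  destruct (square_in_FP D R xs n z0 z1 z' A C) as (p & q & Hp & Hq & Hpq); auto.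
  { intros y Hy; apply Hxs in Hy; apply Hy. }
  apply Hxs in Hp as ((Dp & Np) & Cp); apply Hxs in Hq as (_ & Cq).
  apply (Hc p q Dp); [tauto|exact Hpq|congruence].
Qed.

(** A translate by [xs n] lies below [xs n]. So [T] is regular if no principal down-set is in [U].
    Otherwise take a minimal [f] with [down f] in [U]: if the class of [f] is not in [U], the part
    strictly below [f] is, and it is regular because a translate in [U] would contradict
    minimality. *)
Lemma component_or_regular (T : X -> Prop) (le : X -> X -> Prop) :
  U T ->
  (forall x y z, le x y -> le y z -> le x z) ->
  (forall x y, T x -> T y -> le (op x y) x) ->
  (forall P : X -> Prop, (forall x, P x -> T x) -> (exists x, P x) ->
     exists a, P a /\ forall b, P b -> le b a -> le a b) ->
  (exists f, T f /\ U (fun x => T x /\ le x f /\ le f x)) \/ exists B, regular B.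
Proof.
  intros HT Htr Hle Hwf.
  set (down := fun f x => T x /\ le x f).
  assert (Hdown : forall (B : X -> Prop) xs n, (forall x, B x -> T x) ->
     (forall y, FP X op xs y -> B y) ->
     U (fun w => exists z, FP_from (S n) xs z /\ w = op (xs n) z) ->
     U (down (xs n))).
  { intros B xs n HBT Hxs H.
    generalize (uf_and _ _ HT H); apply uf_mono; intros w (Tw & z & Fz & ->).
    split; [exact Tw|]; apply Hle; apply HBT, Hxs; [apply FP_term|].
    exact (FP_from_FP _ _ _ Fz). }
  destruct (classic (exists f, T f /\ U (down f))) as [Hex|Hno].
  - destruct (Hwf (fun f => T f /\ U (down f))) as (f & (Tf & Uf) & Hmin); [tauto|exact Hex|].
    destruct (uf_cases (fun x => T x /\ le x f /\ le f x) (down f) Uf) as [H|H]; [eauto|].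
    right; eexists; split; [exact H|]; intros xs n Hxs HT'.
    assert (HB := Hxs _ (FP_term xs n)).
    destruct HB as ((Tx & Hx) & HB); apply HB; repeat (split; [assumption|]).
    apply Hmin; [split; [exact Tx|]|exact Hx].
    apply (Hdown _ xs n (fun x Hx => proj1 (proj1 Hx)) Hxs HT').
  - right; exists T; split; [exact HT|]; intros xs n Hxs HT'.
    apply Hno; exists (xs n); split; [apply Hxs, FP_term|].
    apply (Hdown _ xs n (fun x Hx => Hx) Hxs HT').
Qed.


(** The exponent is shifted: [pow x k] is the product of [k + 1] factors [x]. *)
Fixpoint pow (x : X) (k : nat) : X :=
  match k with 0 => x | S k => op (pow x k) x end.

Lemma pow_succ_l (x : X) (k : nat) : pow x (S k) = op x (pow x k).
Proof.
  induction k as [|k IH]; [reflexivity|].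
  change (pow x (S (S k))) with (op (pow x (S k)) x); rewrite IH at 1.
  symmetry; apply op_assoc.
Qed.

Lemma pow_idem (e : X) (k : nat) : op e e = e -> pow e k = e.
Proof. intro H; induction k as [|k IH]; simpl; [|rewrite IH]; auto. Qed.

Lemma abelian_congruence_eq (D : X -> Prop) :
  (forall x y, D x -> D y -> op x y = op y x) ->
  (forall x y, D x -> D y -> D (op x y)) ->
  abelian_congruence D (fun x y => D x /\ D y /\ x = y).
Proof.
  intros Hc Hcl; split.
  - tauto.
  - auto.
  - intros x y (? & ? & ->); auto.
  - intros x y z (? & ? & ->); auto.
  - intros x x' y y' (? & ? & ->) (? & ? & ->); auto.
  - intros x y Dx Dy; repeat split; auto.
Qed.

(** * Commutative semigroups and their archimedean components *)

Section Commutative.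
Hypothesis op_comm : commutative_op X op.

Let N := univ_semilattice_cong X op.

Lemma univ_semilattice_cong_spec : semilattice_congruence X op N.
Proof.
  split; [split; [|split; [|split]]|split].
  - intros x R HR; destruct (HR) as ((Hr & Hs & Ht & Hm) & Hc & Hi); apply Hr.
  - intros x y H R HR; destruct (HR) as ((Hr & Hs & Ht & Hm) & Hc & Hi).
    apply Hs, H, HR.
  - intros x y z H1 H2 R HR; destruct (HR) as ((Hr & Hs & Ht & Hm) & Hc & Hi).
    apply Ht with y; [apply H1, HR|apply H2, HR].
  - intros x y z H; split; intros R HR;
      destruct (HR) as ((Hr & Hs & Ht & Hm) & Hc & Hi); apply (Hm x y z), H, HR.
  - intros x y R HR; destruct (HR) as ((Hr & Hs & Ht & Hm) & Hc & Hi); apply Hc.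
  - intros x R HR; destruct (HR) as ((Hr & Hs & Ht & Hm) & Hc & Hi); apply Hi.
Qed.

Lemma op_swap_inner (a b c d : X) : op (op a b) (op c d) = op (op a c) (op b d).
Proof.
  rewrite <- !op_assoc; f_equal; rewrite !op_assoc; f_equal; apply op_comm.
Qed.

Lemma pow_op (x y : X) (k : nat) : pow (op x y) k = op (pow x k) (pow y k).
Proof. induction k as [|k IH]; simpl; [reflexivity|]. rewrite IH; apply op_swap_inner. Qed.

Lemma pow_add (x : X) (m n : nat) : op (pow x m) (pow x n) = pow x (m + n + 1).
Proof.
  induction n as [|n IH]; simpl.
  - replace (m + 0 + 1) with (S m) by lia; reflexivity.
  - rewrite op_assoc, IH; replace (m + S n + 1) with (S (m + n + 1)) by lia; reflexivity.
Qed.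

Lemma pow_pow (x : X) (m n : nat) : exists k, pow (pow x m) n = pow x k.
Proof.
  induction n as [|n (k & IH)]; simpl; [eauto|].
  exists (k + m + 1); rewrite IH; apply pow_add.
Qed.

(* Mutual divisibility up to powers is a semilattice congruence (Tamura). *)
Lemma univ_semilattice_archimedean (x y : X) :
  N x y -> exists n t, pow x n = op y t.
Proof.
  set (dv := fun x y => exists n t, pow x n = op y t).
  intro H; apply (H (fun x y => dv x y /\ dv y x)); clear H x y.
  assert (Htr : forall x y z, dv x y -> dv y z -> dv x z).
  { intros x y z (n & t & E) (m & s & F).
    destruct (pow_pow x n m) as (k & Hk).
    exists k, (op s (pow t m)); rewrite <- Hk, E, pow_op, F, op_assoc; reflexivity. }
  assert (Hr : forall x, dv x x) by (intro x; exists 1, x; reflexivity).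
  assert (Hm : forall x y z, dv x y -> dv (op z x) (op z y)).
  { intros x y z (n & t & E).
    exists n; rewrite pow_op, E; destruct n as [|n]; [exists t; apply op_assoc|].
    exists (op (pow z n) t); rewrite pow_succ_l; apply op_swap_inner. }
  split; [split; [|split; [|split]]|split].
  - intro x; split; apply Hr.
  - intros x y []; split; assumption.
  - intros x y z [] []; split; eauto.
  - intros x y z []; rewrite !(op_comm _ z); repeat split; apply Hm; assumption.
  - intros x y; rewrite op_comm; split; apply Hr.
  - intro x; split; [exists 0, x; reflexivity|exists 2, x; reflexivity].
Qed.

(** Some power of [x] is a multiple of [c], so the equation for [c] carries over to it; one more
    factor [x] gives the absorbing power. *)
Lemma absorbing_power (x c : X) :
  N c x -> op c x = op c (op x x) -> exists k, op (pow x k) x = pow x k.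
Proof.
  intros HN E.
  destruct univ_semilattice_cong_spec as ((_ & Hs & _) & _).
  destruct (univ_semilattice_archimedean x c) as (n & t & Ht); [apply Hs, HN|].
  exists (S n); simpl; rewrite Ht.
  rewrite <- (op_comm t), <- !op_assoc, E, (op_assoc c); reflexivity.
Qed.

Lemma idempotent_of_absorbing (x : X) (k : nat) :
  op (pow x k) x = pow x k -> op (pow x k) (pow x k) = pow x k.
Proof.
  intro H.
  assert (K : forall j, op (pow x k) (pow x j) = pow x k).
  { induction j as [|j IH]; simpl; [exact H|]. rewrite op_assoc, IH; exact H. }
  apply K.
Qed.

Lemma univ_semilattice_pow (x : X) (k : nat) : N (pow x k) x.
Proof.
  destruct univ_semilattice_cong_spec as ((Hr & _ & Ht & Hm) & _ & Hi).
  induction k as [|k IH]; simpl; [apply Hr|].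
  apply Ht with (op x x); [apply Hm, IH|apply Hi].
Qed.

(** An idempotent equals all its powers, so each of [e] and [f] is a multiple of the other and is
    fixed by it. *)
Lemma component_idempotent_unique (e f : X) :
  N e f -> op e e = e -> op f f = f -> e = f.
Proof.
  assert (K : forall e f, N e f -> op e e = e -> op f f = f -> op f e = e).
  { clear e f; intros e f H He Hf.
    destruct (univ_semilattice_archimedean e f H) as (n & t & E).
    rewrite (pow_idem e n He) in E; rewrite E, op_assoc, Hf; reflexivity. }
  intros H He Hf.
  destruct univ_semilattice_cong_spec as ((_ & Hs & _) & _).
  rewrite <- (K e f H He Hf), op_comm; apply K; auto.
Qed.

(** Here [e] acts as a zero and [pow a k = e] for [a = xs n]. If the translate by [a] were in [U],
    terms [ys j] of the form [op a z] would have a product of [k + 1] of them equal to [e], which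
    the set with [e] removed excludes. *)
Lemma nil_component_regular (f e : X) :
  N e f -> op e e = e -> U (fun x => N x f /\ op e x = e) ->
  U (fun x => x = e) \/ exists B, regular B.
Proof.
  intros Hef He H.
  destruct univ_semilattice_cong_spec as ((_ & Hs & Ht & _) & _).
  destruct (uf_cases (fun x => x = e) _ H) as [K|K]; [auto|right].
  eexists; split; [exact K|]; intros xs n Hxs HT.
  destruct (HSP _ (uf_and _ _ K HT)) as (ys & Hys & _).
  set (a := xs n) in *.
  destruct (Hxs _ (FP_term xs n)) as ((Ha & Hea) & _); fold a in Ha, Hea.
  destruct (univ_semilattice_archimedean a e) as (k & t & Hk).
  { apply Ht with f; auto. }
  assert (Ek : pow a k = e).
  { assert (E : forall j, op e (pow a j) = e).
    { induction j as [|j IH]; simpl; [exact Hea|].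
      rewrite op_assoc, IH; exact Hea. }
    rewrite <- (E k), Hk, op_assoc, He; reflexivity. }
  assert (Hprod : forall j, exists z, op e z = e /\
            Defs.list_prod X op ys 0 (seq 1 j) = op (pow a j) z).
  { assert (Hy : forall j, exists z, op e z = e /\ ys j = op a z).
    { intro j; destruct (Hys _ (FP_term ys j)) as (_ & z & Hz & E).
      exists z; split; [apply Hxs; exact (FP_from_FP _ _ _ Hz)|exact E]. }
    induction j as [|j (z & Hz & E)]; [apply (Hy 0)|].
    destruct (Hy (S j)) as (w & Hw & F).
    exists (op z w); split; [rewrite op_assoc, Hz; exact Hw|].
    rewrite seq_S; unfold Defs.list_prod in *; rewrite fold_left_app, E; simpl.
    rewrite F; apply op_swap_inner. }
  destruct (Hprod k) as (z & Hz & E); rewrite Ek, Hz in E.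
  assert (HF : FP X op ys e).
  { exists 0, (seq 1 k); split; [|symmetry; exact E].
    change (StronglySorted lt (seq 0 (S k))).
    generalize (S k), 0; clear; induction n as [|n IH]; intro a; simpl; constructor; auto.
    apply Forall_forall; intros x Hx; apply in_seq in Hx; lia. }
  apply Hys in HF as ((_ & HF) & _); auto.
Qed.

Lemma commutative_idempotent : univ_semilattice_wf X op -> idempotent_uf X op U.
Proof.
  intro Hwf.
  destruct univ_semilattice_cong_spec as ((Hr & Hs & Ht & Hm) & Hc & Hi).
  destruct (component_or_regular (fun _ => True) (fun x y => N (op x y) x))
    as [(f & _ & Hf)|(B & HB)]; [apply HU| | | | |exact (regular_idempotent B HB)].
  - intros x y z H1 H2.
    apply Ht with (op (op x y) z); [apply Hm, Hs, H1|].
    apply Ht with (op x y); [|exact H1].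
    rewrite <- op_assoc; apply Hm, H2.
  - intros x y _ _.
    apply Ht with (op (op x x) y); [|apply Hm, Hi].
    rewrite <- !op_assoc, (op_comm y); apply Hr.
  - intros P _ HP; destruct (Hwf P HP) as (a & Pa & Ha); exists a; split; [exact Pa|].
    intros b Pb Hb; specialize (Ha b Pb Hb).
    apply Ht with (op a a); [apply Hm; exact Ha|apply Hi].
  - set (D := fun x => N x f).
    assert (HD : U D).
    { revert Hf; apply uf_mono; intros x (_ & H1 & H2).
      apply Ht with (op x f); [apply Hs, H1|]; apply Ht with (op f x); auto. }
    assert (HDm : forall x y, D x -> D y -> D (op x y)).
    { intros x y Hx Hy; apply Ht with (op f y); [apply Hm, Hx|].
      apply Ht with (op f f); [apply Hm, Hy|apply Hi]. }
    (* The least cancellative congruence on the component [D]. *)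
    set (R := fun x y => D x /\ D y /\ exists c, D c /\ op c x = op c y).
    assert (A : abelian_congruence D R).
    { split; unfold R.
      - tauto.
      - intros x Hx; split; [auto|split; [auto|]]; exists x; auto.
      - intros x y (? & ? & c & ? & ?); split; [auto|split; [auto|]]; exists c; auto.
      - intros x y z (? & ? & c & Hcd & E) (? & ? & d & Hd & F); split; [auto|split; [auto|]].
        exists (op d c); split; auto.
        rewrite <- op_assoc, E, op_assoc, (op_comm d), <- op_assoc, F, op_assoc.
        reflexivity.
      - intros x x' y y' (? & ? & c & Hcd & E) (? & ? & d & Hd & F); split; [auto|split; [auto|]].
        exists (op c d); split; auto.
        rewrite !(op_swap_inner c d), E, F; reflexivity.
      - intros x y Hx Hy; rewrite (op_comm y x); split; [auto|split; [auto|]].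
        exists x; split; [exact Hx|reflexivity]. }
    assert (C : cancellative R D).
    { intros x y c Hx Hy Hcd (_ & _ & d & Hd & E); split; [auto|split; [auto|]].
      exists (op d c); split; auto.
      rewrite <- !op_assoc, !(op_comm c); exact E. }
    destruct (cancellative_regular D R A C HD) as [H|(B & HB)];
      [|exact (regular_idempotent B HB)].
    (* An element idempotent modulo [R] has a power that is idempotent and absorbs it. *)
    assert (He : forall x, D x /\ R (op x x) x ->
              exists e, N e f /\ op e e = e /\ op e x = e).
    { intros x (Hx & _ & _ & c & Hcd & E).
      destruct (absorbing_power x c) as (k & Hk); [apply Ht with f; auto|auto|].
      exists (pow x k); repeat split; auto using idempotent_of_absorbing.
      apply Ht with x; [apply univ_semilattice_pow|exact Hx]. }
    destruct (classic (exists x, D x /\ R (op x x) x)) as [(x & Hx)|Hno].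
    2: { exfalso; apply (uf_false _ H); eauto. }
    destruct (He x Hx) as (e & Hef & Hee & _).
    destruct (nil_component_regular f e Hef Hee) as [K|(B & HB)].
    + revert H; apply uf_mono; intros y Hy.
      destruct (He y Hy) as (e' & He'f & He'e & He'y).
      (* The absorbing idempotent found for [y] is the one found for [x], so a single [e] is a zero
         for all of them. *)
      rewrite (component_idempotent_unique e e') by (auto; apply Ht with f; auto).
      split; [apply Hy|exact He'y].
    + exact (principal_idempotent e K).
    + exact (regular_idempotent B HB).
Qed.

End Commutative.

(** * Inverse semigroups and induction on the solvability class *)

Section Inverse.
Hypothesis inverse_op : inverse_semigroup X op.

Let inverses (x y : X) : Prop := op (op x y) x = x /\ op (op y x) y = y.

Lemma idem_absorb (e x : X) : op e e = e -> op e (op e x) = op e x.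
Proof. intro H; rewrite op_assoc, H; reflexivity. Qed.

Lemma inverses_unique (x y z : X) : inverses x y -> inverses x z -> y = z.
Proof.
  intros Hy Hz; destruct (inverse_op x) as (w & _ & Hw).
  rewrite <- (Hw y Hy); exact (Hw z Hz).
Qed.

(** If [y] is the inverse of [op e f], so is [op f (op y e)]; their equality makes [y] idempotent.
    Then [y] is its own inverse, hence equal to [op e f]. *)
Lemma idem_op_idem (e f : X) : op e e = e -> op f f = f -> op (op e f) (op e f) = op e f.
Proof.
  intros He Hf; destruct (inverse_op (op e f)) as (y & (H1 & H2) & _).
  rewrite <- !op_assoc in H1, H2.
  assert (H3 : forall x, op y (op e (op f (op y x))) = op y x).
  { intro x; transitivity (op (op y (op e (op f y))) x).
    - rewrite <- !op_assoc; reflexivity.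
    - rewrite H2; reflexivity. }
  assert (Ey : op f (op y e) = y).
  { apply (inverses_unique (op e f)); split; rewrite <- !op_assoc; auto.
    - rewrite (idem_absorb f _ Hf), (idem_absorb e _ He); exact H1.
    - rewrite (idem_absorb f _ Hf), (idem_absorb e _ He), H3; reflexivity. }
  assert (Hy : op y y = y).
  { rewrite <- Ey at 1 2 3; rewrite <- !op_assoc, H3; reflexivity. }
  assert (E : op e f = y).
  { apply (inverses_unique y); split.
    - rewrite <- !op_assoc; exact H2.
    - rewrite <- !op_assoc; exact H1.
    - rewrite Hy; exact Hy.
    - rewrite Hy; exact Hy. }
  rewrite E; exact Hy.
Qed.

(** The idempotent [op e f] is its own inverse, and [op f e] is an inverse of it as well. *)
Lemma idem_comm (e f : X) : op e e = e -> op f f = f -> op e f = op f e.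
Proof.
  intros He Hf.
  pose proof (idem_op_idem e f He Hf) as H1; pose proof (idem_op_idem f e Hf He) as H2.
  rewrite <- !op_assoc in H1, H2.
  apply (inverses_unique (op e f)); split; rewrite <- !op_assoc;
    rewrite ?(idem_absorb f _ Hf), ?(idem_absorb e _ He), ?(idem_absorb f _ Hf); auto.
  - rewrite H1; exact H1.
  - rewrite H1; exact H1.
Qed.

(* Modulo [R], the classes of mutual divisibility are groups. *)
Lemma inverse_quotient_regular (T : X -> Prop) (R : X -> X -> Prop) :
  abelian_congruence T R ->
  (forall x, T x -> exists y, T y /\ inverses x y) ->
  idempotents_wf X op -> U T ->
  U (fun x => T x /\ R (op x x) x) \/ exists B, regular B.
Proof.
  intros A HT Hwf UT.
  pose proof (ac_closed _ _ A) as Tm; pose proof (ac_refl _ _ A) as Rr.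
  pose proof (ac_sym _ _ A) as Rs; pose proof (ac_trans _ _ A) as Rt.
  pose proof (ac_mul _ _ A) as Rm; pose proof (ac_comm _ _ A) as Rc.
  set (le := fun x y => exists t, T t /\ R (op y t) x).
  assert (le_trans : forall x y z, le x y -> le y z -> le x z).
  { intros x y z (t & Tt & Ht) (s & Ts & Hs); exists (op s t); split; auto.
    rewrite op_assoc; apply Rt with (op y t); auto. }
  assert (le_op : forall x y, T x -> T y -> le (op x y) x).
  { intros x y Tx Ty; exists y; auto. }
  assert (le_idem : forall x e, T e -> op e e = e -> le x e -> R (op e x) x).
  { intros x e Te He (t & Tt & Ht).
    apply Rt with (op e (op e t)); [auto|]; rewrite (idem_absorb e t He); exact Ht. }
  (* Modulo [R], [op c' c] is an identity for everything below [c]; cancellation of [c] rests on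
     this. *)
  assert (le_unit : forall x c c', T c -> T c' -> inverses c c' -> le x c ->
            R (op (op c' c) x) x).
  { intros x c c' Tc Tc' (E & _) (t & Tt & Ht).
    assert (Tx : T x) by apply (ac_dom _ _ A _ _ Ht).
    apply Rt with (op (op c c') x); [auto|].
    apply Rt with (op (op c c') (op c t)); [auto|].
    rewrite op_assoc, E; exact Ht. }
  destruct (component_or_regular T le UT le_trans le_op) as [(f & Tf & Hf)|HB];
    [|set (D := fun x => T x /\ le x f /\ le f x) in Hf|auto].
  - intros P HP (a0 & Pa0).
    (* Every [a] is equivalent to the idempotent [op a a'], so a minimal idempotent among those
       equivalent to members of [P] is taken. *)
    destruct (Hwf (fun e => op e e = e /\ T e /\ exists a, P a /\ le e a /\ le a e))
      as (e & (He & Te & a & Pa & Hea & Hae) & Hmin).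
    { tauto. }
    { destruct (HT a0 (HP _ Pa0)) as (a' & Ta' & E & _).
      exists (op a0 a'); split; [rewrite op_assoc, E; reflexivity|].
      split; [auto|]; exists a0; split; [exact Pa0|]; split; [auto|].
      exists a0; rewrite E; auto. }
    exists a; split; [exact Pa|]; intros b Pb Hba.
    destruct (HT b (HP _ Pb)) as (b' & Tb' & E & _).
    assert (Tb := HP _ Pb).
    (* An idempotent below [e] and equivalent to [b], so minimality forces [g = e]. *)
    set (g := op (op b b') e).
    assert (Hbb : op (op b b') (op b b') = op b b').
    { rewrite op_assoc, E; reflexivity. }
    assert (Hgb : le g b).
    { exists (op b' e); split; [auto|]; unfold g; rewrite <- op_assoc; auto. }
    assert (Hbg : le b g).
    { exists b; split; [auto|]; unfold g; rewrite <- op_assoc.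
      apply Rt with (op (op b b') b); [|rewrite E; auto].
      apply Rm; [auto|]; apply le_idem; eauto. }
    assert (Eg : g = e).
    { apply Hmin.
      - split; [apply idem_op_idem; auto|]; split; [unfold g; auto|eauto].
      - unfold g; rewrite <- op_assoc, He; reflexivity. }
    rewrite Eg in Hgb; eauto.
  - destruct (HT f Tf) as (f' & Tf' & Hff').
    assert (Dm : forall x y, D x -> D y -> D (op x y)).
    { intros x y (Tx & Hxf & s & Ts & Hs) (Ty & Hyf & t & Tt & Ht).
      split; [auto|]; split; [eauto|].
      (* Modulo [R], [f = x s = y t], hence [f = f f' f = x s f' y t = x y s f' t]. *)
      exists (op (op s f') t); split; [auto|].
      apply Rt with (op (op f f') f); [|rewrite (proj1 Hff'); auto].
      apply Rs, Rt with (op (op (op x s) f') (op y t)); [auto|].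
      replace (op (op (op x s) f') (op y t)) with (op (op x (op (op s f') y)) t)
        by (rewrite !op_assoc; reflexivity).
      replace (op (op x y) (op (op s f') t)) with (op (op x (op y (op s f'))) t)
        by (rewrite !op_assoc; reflexivity).
      auto. }
    set (RD := fun x y => D x /\ D y /\ R x y).
    destruct (cancellative_regular D RD) as [H|H]; auto.
    + split; unfold RD.
      * tauto.
      * intros x Dx; split; [auto|]; split; [auto|]; apply Rr, Dx.
      * intros x y (? & ? & ?); auto.
      * intros x y z (? & ? & ?) (? & ? & ?); eauto.
      * intros x x' y y' (? & ? & ?) (? & ? & ?); auto.
      * intros x y Dx Dy; split; [auto|]; split; [auto|]; apply Rc; [apply Dx|apply Dy].
    + intros x y c Dx Dy Dc (_ & _ & H); split; [auto|]; split; [auto|].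
      destruct Dx as (Tx & Hxf & _), Dy as (Ty & Hyf & _), Dc as (Tc & _ & Hfc).
      destruct (HT c Tc) as (c' & Tc' & Hc).
      apply Rt with (op (op c' c) x); [apply Rs, le_unit; eauto|].
      apply Rt with (op (op c' c) y); [|apply le_unit; eauto].
      rewrite <- !op_assoc; apply Rm; [auto|].
      apply Rt with (op x c); [auto|]; apply Rt with (op y c); auto.
    + left; revert H; apply uf_mono; intros x (Dx & _ & _ & H); split; [apply Dx|exact H].
Qed.

(** Idempotents below each other are equal, so a class in [U] makes [U] principal. *)
Lemma semilattice_idempotent (E : X -> Prop) :
  idempotents_wf X op ->
  (forall x, E x -> op x x = x) -> U E -> idempotent_uf X op U.
Proof.
  intros Hwf HE UE.
  destruct (component_or_regular E (fun x y => op x y = x) UE)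
    as [(f & Ef & Hf)|(B & HB)]; [| | | |exact (regular_idempotent B HB)].
  - intros x y z H1 H2; rewrite <- H1 at 1; rewrite <- op_assoc, H2; exact H1.
  - intros x y Ex Ey; rewrite <- op_assoc, (idem_comm y x), idem_absorb; auto.
  - intros P HP Hex; destruct (Hwf P) as (a & Pa & Ha); [intros; apply HE; auto|exact Hex|].
    exists a; split; [exact Pa|]; intros b Pb Hb.
    rewrite (Ha b Pb Hb); apply HE; auto.
  - apply (principal_idempotent f); revert Hf; apply uf_mono.
    intros x (Ex & H1 & H2); rewrite <- H1, idem_comm; auto.
Qed.

(** Induction on the class. Either a regular set appears, or the elements of [T] idempotent modulo
    the congruence form a set in [U]: a semilattice in class 1, where the congruence is equality,
    and otherwise an inverse subsemigroup of smaller class. *)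
Lemma solvable_idempotent (n : nat) (T : X -> Prop) :
  idempotents_wf X op ->
  solvable_class X op n T ->
  (forall x y, T x -> T y -> T (op x y)) ->
  (forall x, T x -> exists y, T y /\ inverses x y) ->
  U T -> idempotent_uf X op U.
Proof.
  intros Hwf Hn; induction Hn as [T Hc|n T g Hg Hc _ IH]; intros Tm Ti UT.
  - pose proof (abelian_congruence_eq T Hc Tm) as A.
    destruct (inverse_quotient_regular _ _ A Ti Hwf UT) as [H|(B & HB)];
      [|exact (regular_idempotent B HB)].
    apply (semilattice_idempotent _ Hwf) in H; [exact H|].
    intros x (_ & _ & _ & E); exact E.
  - set (R := fun x y => T x /\ T y /\ g x y).
    assert (A : abelian_congruence T R).
    { destruct Hg as (Gr & Gs & Gt & Gm); split; unfold R.
      - tauto.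
      - auto.
      - intros x y (? & ? & ?); auto.
      - intros x y z (? & ? & ?) (? & ? & ?); eauto.
      - intros x x' y y' (? & ? & ?) (? & ? & ?); split; [auto|]; split; [auto|].
        apply (Gt _ (op x' y)); auto; [apply (Gm x x' y)|apply (Gm y y' x')]; auto.
      - auto. }
    pose proof (ac_refl _ _ A) as Rr; pose proof (ac_sym _ _ A) as Rs.
    pose proof (ac_trans _ _ A) as Rt; pose proof (ac_mul _ _ A) as Rm.
    pose proof (ac_comm _ _ A) as Rc.
    destruct (inverse_quotient_regular _ _ A Ti Hwf UT) as [H|(B & HB)];
      [|exact (regular_idempotent B HB)].
    apply IH.
    + intros x y (Tx & Hx) (Ty & Hy); split; [auto|].
      assert (K : R (op (op x y) (op x y)) (op x y)); [|apply K].
      apply Rt with (op (op x x) (op y y)); [|apply Rm; repeat split; auto].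
      replace (op (op x y) (op x y)) with (op x (op (op y x) y))
        by (rewrite !op_assoc; reflexivity).
      replace (op (op x x) (op y y)) with (op x (op (op x y) y))
        by (rewrite !op_assoc; reflexivity).
      auto.
    + intros x (Tx & Hx); destruct (Ti x Tx) as (y & Ty & E1 & E2).
      exists y; split; [split; [exact Ty|]|split; assumption].
      assert (K : R (op y y) y); [|apply K].
      (* Since [x] and [op x x] are congruent, [y = y x y] is congruent to [y x x y = w], a product
         of two idempotents. *)
      set (w := op (op y x) (op x y)).
      assert (Ew : op w w = w).
      { apply idem_op_idem; rewrite op_assoc; congruence. }
      assert (Hw : R y w).
      { rewrite <- E2 at 1; unfold w; rewrite (op_assoc (op y x) x y).
        rewrite <- (op_assoc y x x); repeat apply Rm; auto.
        apply Rs; repeat split; auto. }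
      apply Rt with (op w w); [auto|]; rewrite Ew; auto.
    + revert H; apply uf_mono; intros x (Tx & _ & _ & Hx); auto.
Qed.

End Inverse.

End StronglyProductive.

Theorem mainTheorem1 (S : Type) (op : S -> S -> S)
  (Hassoc : associative_op S op) :
  ((commutative_op S op /\ univ_semilattice_wf S op) \/
   (solvable_inverse_semigroup S op /\ idempotents_wf S op)) ->
  forall U : (S -> Prop) -> Prop,
    ultrafilter S U -> strongly_productive S op U -> idempotent_uf S op U.
Proof.
  intros [(Hc & Hwf)|((Hi & n & Hn) & Hwf)] U HU HSP.
  - exact (commutative_idempotent S op Hassoc U HU HSP Hc Hwf).
  - apply (solvable_idempotent S op Hassoc U HU HSP Hi n (fun _ => True) Hwf Hn); auto.
    + intros x _; destruct (Hi x) as (y & Hy & _); exists y; auto.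
    + apply HU.
Qed.
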